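(* Let $1\le r<n$, $\mu>0$, and let $A(t)\in\mathbb{R}^{n\times n}$, $C(t)\in\mathbb{R}^{p\times n}$ and $H(t)$ (with $p$ rows) depend smoothly on $t$, with $A(t)$ and $H(t)H(t)'$ invertible for all $t$. Consider the low-rank Riccati dynamics for $P=URU'\in S^+(r,n)$, $(U,R)\in\mathrm{St}(r,n)\times P_+(r)$, $$\frac{d}{dt}U=(I-UU')AU,\qquad \frac{d}{dt}R=A_UR+RA_U'+\mu^2I-RC_U'(HH')^{-1}C_UR,$$ where $A_U=U'AU$ and $C_U=CU$. This dynamics is a strict contraction for the metric $g$ of $S^+(r,n)$ (defined in the context) on any compact subset of $S^+(r,n)$ on which the span is held fixed. That is: for every compact $N\subset S^+(r,n)$ all of whose elements have the same column span, represented by a fixed $U\in\mathrm{St}(r,n)$, there is $\lambda>0$ such that, with $U$ held fixed, for every solution $R(t)$ of the second equation and every solution $\delta R(t)$ (with values in symmetric $r\times r$ matrices) of its linearization along $R(t)$, at every time $t$ with $UR(t)U'\in N$, $$\frac{d}{dt}\,g\big((0,\delta R),(0,\delta R)\big)\le-2\lambda\, g\big((0,\delta R),(0,\delta R)\big),$$ where $g$ is evaluated at $UR(t)U'$.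
   Context: $M'$ denotes the transpose of $M$. $P_+(r)$ is the cone of symmetric positive definite $r\times r$ matrices; $\mathrm{St}(r,n)$ is the Stiefel manifold of $n\times r$ real matrices $U$ with $U'U=I_r$; $S^+(r,n)$ is the manifold of symmetric positive semidefinite $n\times n$ matrices of rank $r$. Every $P\in S^+(r,n)$ can be written $P=URU'$ with $(U,R)\in\mathrm{St}(r,n)\times P_+(r)$, uniquely up to $(U,R)\equiv(UO,O'RO)$, $O\in O(r)$, so $S^+(r,n)\cong(\mathrm{St}(r,n)\times P_+(r))/O(r)$. Metric: given a representative $(U,R)$ of $P=URU'$, tangent vectors at $P$ are represented by horizontal pairs $(\Delta,D)$ with $\Delta=U_\perp B$, $B\in\mathbb{R}^{(n-r)\times r}$ ($U_\perp$ having orthonormal columns spanning the orthogonal complement of $\mathrm{span}(U)$), and $D$ a symmetric $r\times r$ matrix; the metric is $$g_{(U,R)}\big((\Delta_1,D_1),(\Delta_2,D_2)\big)=\mathrm{Tr}(\Delta_1'\Delta_2)+\mathrm{Tr}(R^{-1}D_1R^{-1}D_2).$$ A dynamical system on a Riemannian manifold is a strict contraction on a set $N$ if there is $\lambda>0$ such that infinitesimal displacements $\delta X$ transported by the flow satisfy $\frac{d}{dt}g(\delta X,\delta X)\le-2\lambda g(\delta X,\delta X)$ at points of $N$. *)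

(* Defs.v *)
From HB Require Import structures.
From mathcomp Require Import all_boot all_order all_algebra.
From mathcomp Require Import all_classical all_reals all_analysis.

Set Implicit Arguments.
Unset Strict Implicit.
Unset Printing Implicit Defensive.

Import Order.TTheory GRing.Theory Num.Theory.
Import numFieldNormedType.Exports.

Local Open Scope classical_set_scope.
Local Open Scope ring_scope.

Section Dynamics.
Context {K : realType}.

Definition smooth {V : normedModType K} (f : K -> V) : Prop :=
  forall (k : nat) (t : K), derivable (derive1n k f) t 1.

Definition solves_ode {V : normedModType K} (F : K -> V -> V) (I : set K)
    (x : K -> V) : Prop :=
  forall t, I t -> is_derive t 1 x (F t (x t)).

(* Infinitesimal displacements transported by the flow along x are the
   solutions of the linearized equation dx' = DF_t(x) dx. *)
Definition linearization {V : normedModType K} (F : K -> V -> V) (x : K -> V) :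
    K -> V -> V :=
  fun t v => 'd (F t) (x t) v.

(* The manifold M is given as a subset of the normed space V, with tangent
   spaces all equal to the subspace T; g x v w is the metric at x. Trajectories
   may be local in time: I is any open interval, bounded or not. *)
Definition strict_contraction {V : normedModType K} (M T : set V)
    (g : V -> V -> V -> K) (F : K -> V -> V) (N : set V) : Prop :=
  exists2 lambda : K, 0 < lambda &
    forall (I : set K) (x dx : K -> V),
      open I -> is_interval I ->
      (forall t, I t -> M (x t)) -> (forall t, I t -> T (dx t)) ->
      solves_ode F I x -> solves_ode (linearization F x) I dx ->
      forall t, I t -> N (x t) ->
        let e := fun s => g (x s) (dx s) (dx s) in
        derivable e t 1 /\ derive1 e t <= - (2 * lambda) * e t.

End Dynamics.

Section LowRank.
Context {K : realType}.

Definition symmetric_matrices (r : nat) : set 'M[K]_r := [set D | D^T = D].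

Definition pos_def (r : nat) : set 'M[K]_r :=
  [set R | R^T = R /\
           forall v : 'cV[K]_r, v != 0 -> 0 < (v^T *m R *m v) ord0 ord0].

Definition stiefel (r n : nat) : set 'M[K]_(n, r) :=
  [set U | U^T *m U = 1%:M].

Definition psd_rank (r n : nat) : set 'M[K]_n :=
  [set P | [/\ P^T = P,
               forall v : 'cV[K]_n, 0 <= (v^T *m P *m v) ord0 ord0
             & \rank P = r]].

(* The row space of a transpose is the column space. *)
Definition same_span (m k n : nat) (P : 'M[K]_(n, m)) (U : 'M[K]_(n, k)) : Prop :=
  (P^T :=: U^T)%MS.

(* Tangent vectors of psd_rank at U R U^T are represented by the horizontal
   pairs (Delta, D) at (U, R): U^T Delta = 0 and D symmetric. The metric is the
   restriction to such pairs of the formula below. *)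
Definition lowrank_metric (r n : nat) (UR X Y : 'M[K]_(n, r) * 'M[K]_r) : K :=
  \tr (X.1^T *m Y.1) + \tr (invmx UR.2 *m X.2 *m invmx UR.2 *m Y.2).

(* The right-hand side (dU/dt, dR/dt) at (U, R). *)
Definition lowrank_riccati (r n p q : nat) (mu : K) (A : K -> 'M[K]_n)
    (C : K -> 'M[K]_(p, n)) (H : K -> 'M[K]_(p, q)) (t : K)
    (UR : 'M[K]_(n, r) * 'M[K]_r) : 'M[K]_(n, r) * 'M[K]_r :=
  let: (U, R) := UR in
  let AU := U^T *m A t *m U in
  let CU := C t *m U in
  ((1%:M - U *m U^T) *m A t *m U,
   AU *m R + R *m AU^T + (mu ^+ 2)%:M
     - R *m CU^T *m invmx (H t *m (H t)^T) *m CU *m R).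

End LowRank.

(* Main.v *)
Require Import Defs.
From HB Require Import structures.
From mathcomp Require Import all_boot all_order all_algebra.
From mathcomp Require Import all_classical all_reals all_analysis.
From mathcomp Require Import ring lra.

Set Implicit Arguments.
Unset Strict Implicit.
Unset Printing Implicit Defensive.

Import Order.TTheory GRing.Theory Num.Theory.
Import numFieldNormedType.Exports.

Local Open Scope classical_set_scope.
Local Open Scope ring_scope.

(* Write S = R^-1 and G = C_U' (HH')^-1 C_U. Along the flow X = S D, where D is
   the transported displacement, satisfies
     X' = X A_U' - A_U' X - mu^2 S X - X G R,
   and the metric is e = tr (X X). The A_U terms cancel under the trace, leaving
     e' = - 2 mu^2 tr M - 2 tr (G D S D),  where M = S D S D S.
   The last trace is nonnegative since G is a Gram matrix. As e = tr (R M) with M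
   positive semidefinite, e <= r b tr M whenever the entries of R are bounded by
   b, which compactness of N provides; hence the rate lambda = mu^2 / (r b). *)

(** * Differential calculus of matrix-valued maps *)

Section MatrixCalculus.
Context {K : realFieldType} {V : normedModType K}.

Lemma differentiable_mx m n (M : V -> 'M[K]_(m, n)) x :
  (forall i j, differentiable (fun y => M y i j) x) -> differentiable M x.
Proof.
move=> dM.
(* Expansion on the elementary matrices, with the index pairs enumerated by a single ordinal so that
   [differentiable_sum] applies. *)
have -> : M = \sum_(k < #|{: 'I_m * 'I_n}|) (fun y =>
    M y (enum_val k).1 (enum_val k).2 *:
    delta_mx (enum_val k).1 (enum_val k).2).
  apply/funext => y; rewrite fct_sumE {1}[M y]matrix_sum_delta pair_big /=.
  rewrite (reindex (@enum_val _ {: 'I_m * 'I_n})) //=.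
  exact/onW_bij/enum_val_bij.
by apply: differentiable_sum => k; apply: differentiableZl.
Qed.

Lemma differentiable_mulmx m n p (M : V -> 'M[K]_(m, n))
    (N : V -> 'M[K]_(n, p)) x :
  differentiable M x -> differentiable N x ->
  differentiable (fun y => M y *m N y) x.
Proof.
move=> dM dN; apply: differentiable_mx => i j.
have -> : (fun y => (M y *m N y) i j) =
    \sum_k ((fun y => M y i k) * (fun y => N y k j)).
  by apply/funext => y; rewrite fct_sumE mxE.
apply: differentiable_sum => k; apply: differentiableM.
- exact: (differentiable_comp dM (differentiable_coord _ i k)).
- exact: (differentiable_comp dN (differentiable_coord _ k j)).
Qed.

Lemma is_derive_mxP m n (M : V -> 'M[K]_(m, n)) (dM : 'M[K]_(m, n)) x v :
  is_derive x v M dM <-> forall i j, is_derive x v (fun y => M y i j) (dM i j).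
Proof.
split=> [[dvM <-] i j|dvM].
  have dvMij := (derivable_mxP M x v).1 dvM i j.
  by apply: DeriveDef => //; rewrite derive_mx // mxE.
have dvb : derivable M x v by apply/derivable_mxP => i j; have [] := dvM i j.
apply: DeriveDef => //; rewrite derive_mx //.
by apply/matrixP => i j; rewrite mxE; have [] := dvM i j.
Qed.

Lemma is_derive_mulmx m n p (M : V -> 'M[K]_(m, n)) (N : V -> 'M[K]_(n, p))
    (dM : 'M[K]_(m, n)) (dN : 'M[K]_(n, p)) x v :
  is_derive x v M dM -> is_derive x v N dN ->
  is_derive x v (fun y => M y *m N y) (dM *m N x + M x *m dN).
Proof.
move=> /is_derive_mxP hM /is_derive_mxP hN; apply/is_derive_mxP => i j.
have -> : (fun y => (M y *m N y) i j) =
    \sum_k ((fun y => M y i k) * (fun y => N y k j)).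
  by apply/funext => y; rewrite fct_sumE mxE.
have := fun k => is_deriveM (hM i k) (hN k j).
move=> /is_derive_sum/is_derive_eq; apply.
rewrite !mxE -big_split /=; apply: eq_bigr => k _.
by rewrite [RHS]addrC; congr (_ + _); exact: mulrC.
Qed.

Lemma is_derive_mxtrace n (M : V -> 'M[K]_n) (dM : 'M[K]_n) x v :
  is_derive x v M dM -> is_derive x v (fun y => \tr (M y)) (\tr dM).
Proof.
move=> /is_derive_mxP hM.
have -> : (fun y => \tr (M y)) = \sum_i (fun y => M y i i).
  by apply/funext => y; rewrite fct_sumE.
by have := fun i => hM i i => /is_derive_sum/is_derive_eq; exact.
Qed.

Lemma derivable_prod (I : Type) (s : seq I) (f : I -> V -> K) x v :
  (forall i, derivable (f i) x v) ->
  derivable (fun y => \prod_(i <- s) f i y) x v.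
Proof.
move=> df; elim: s => [|i s IHs].
  under eq_fun do rewrite big_nil; exact: derivable_cst.
under eq_fun do rewrite big_cons; exact: derivableM.
Qed.

Lemma derivable_det n (M : V -> 'M[K]_n) x v :
  derivable M x v -> derivable (fun y => \det (M y)) x v.
Proof.
move=> /derivable_mxP dM; rewrite /determinant.
elim: (index_enum _) => [|s l IHl].
  under eq_fun do rewrite big_nil; exact: derivable_cst.
under eq_fun do rewrite big_cons; apply: derivableD => //.
by apply: derivableM; [exact: derivable_cst | exact: derivable_prod].
Qed.

Lemma derivable_adj n (M : V -> 'M[K]_n) x v :
  derivable M x v -> derivable (fun y => \adj (M y)) x v.
Proof.
move=> /derivable_mxP dM; apply/derivable_mxP => i j.
under eq_fun do rewrite mxE.
apply: derivableM; first exact: derivable_cst.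
apply: derivable_det; apply/derivable_mxP => k l.
under eq_fun do rewrite !mxE; exact: dM.
Qed.

(** Cramer's formula gives derivability of the inverse; the value then comes from differentiating
    the constant product [invmx (M y) *m M y]. *)
Lemma is_derive_invmx n (M : V -> 'M[K]_n) (dM : 'M[K]_n) x v :
  (\forall y \near x, M y \in unitmx) -> is_derive x v M dM ->
  is_derive x v (fun y => invmx (M y)) (- (invmx (M x) *m dM *m invmx (M x))).
Proof.
move=> uM hM; have uMx : M x \in unitmx := nbhs_singleton uM.
have dvM : derivable M x v by case: hM.
have dI : derivable (fun y => invmx (M y)) x v.
  (* [invmx] returns a singular matrix unchanged, so the cofactor formula is only matched near [x],
     where [M y] is invertible. *)
  pose f y := (\det (M y))^-1 *: \adj (M y).
  apply: (@near_eq_derivable _ _ _ f) => //.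
    by near=> y; rewrite /f /invmx ifT //; near: y.
  apply/derivable_mxP => i j; under eq_fun do rewrite mxE.
  have dadj := (derivable_mxP _ _ _).1 (derivable_adj dvM) i j.
  apply: derivableM => //.
  apply: derivableV; last exact: derivable_det.
  by rewrite -unitfE -unitmxE.
have : is_derive x v (fun y => invmx (M y) *m M y) 0.
  apply: (@near_eq_is_derive _ _ _ (cst 1%:M)) => //.
  by near=> y; rewrite mulVmx //; near: y.
case=> _; have [_ ->] := is_derive_mulmx (derivableP dI) hM => /eqP.
rewrite addr_eq0 => /eqP E; apply: DeriveDef => //.
by rewrite -[LHS](mulmxK uMx) E mulNmx.
Unshelve. all: by end_near. Qed.

End MatrixCalculus.

(** * The Riccati vector field, its derivative and the trace identity *)

Section Riccati.
Context {K : realFieldType} {r : nat}.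
Implicit Types A B E G R D : 'M[K]_r.

(** Differentiability identifies the differential used in [linearization] with the directional
    derivative computed in [is_derive_riccati]. *)
Lemma differentiable_riccati A B E G R :
  differentiable (fun X => A *m X + X *m B + E - X *m G *m X) R.
Proof.
apply: differentiableB; last first.
  by apply: differentiable_mulmx => //; exact: differentiable_mulmx.
by apply: differentiableD => //; apply: differentiableD;
  exact: differentiable_mulmx.
Qed.

Lemma is_derive_riccati A B E G R D :
  is_derive R D (fun X => A *m X + X *m B + E - X *m G *m X)
    (A *m D + D *m B - (D *m G *m R + R *m G *m D)).
Proof.
have i := is_derive_id R D.
have hA := is_derive_mulmx (is_derive_cst A R D) i.
have hB := is_derive_mulmx i (is_derive_cst B R D).
have hG := is_derive_mulmx (is_derive_mulmx i (is_derive_cst G R D)) i.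
have hE := is_deriveD (is_deriveD hA hB) (is_derive_cst E R D).
apply: (is_derive_eq (is_deriveB hE hG)).
by rewrite /= !mulmx0 !mul0mx !addr0 add0r.
Qed.

(* If R solves the Riccati equation and D its linearization along R, then dX
   is the derivative of X = R^-1 D, and the left-hand side that of tr (X X). *)
Lemma trace_riccati (m : K) A G R D (S := invmx R)
    (dR := A *m R + R *m A^T + m%:M - R *m G *m R)
    (dD := A *m D + D *m A^T - (D *m G *m R + R *m G *m D))
    (dX := - (S *m dR *m S) *m D + S *m dD) :
  R \in unitmx ->
  \tr (dX *m (S *m D) + S *m D *m dX) =
    - 2 * (m * \tr (S *m D *m S *m D *m S) + \tr (G *m D *m S *m D)).
Proof.
move=> uR.
have SdRS : S *m dR *m S = S *m A + A^T *m S + m *: (S *m S) - G.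
  rewrite /dR !(mulmxBr, mulmxDr, mulmxBl, mulmxDl) !mulmxA !mulVmx // !mul1mx.
  by rewrite !mulmxK // mul_mx_scalar -scalemxAl.
have SdD : S *m dD =
    S *m A *m D + S *m D *m A^T - (S *m D *m G *m R + G *m D).
  by rewrite /dD mulmxBr !mulmxDr !mulmxA !mulVmx // !mul1mx.
(* The terms [S *m A *m D] and [G *m D] cancel. The matrix products are made atoms so that [ring]
   can work entry by entry. *)
have -> : dX = S *m D *m A^T - A^T *m (S *m D) - m *: (S *m S *m D)
    - S *m D *m G *m R.
  rewrite /dX SdRS SdD mulNmx !(mulmxBl, mulmxDl) -scalemxAl !mulmxA.
  move: (S *m A *m D) (A^T *m S *m D) (m *: _) (G *m D) (S *m D *m A^T)
    (S *m D *m G *m R) => x1 x2 x3 x4 x5 x6.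
  by apply/matrixP => i j; rewrite !mxE; ring.
(* By cyclicity both halves have the same trace, whence the factor 2. *)
rewrite mxtraceD [X in _ + X]mxtrace_mulC -mulr2n -[LHS]mulr_natl mulNr -mulrN.
congr (_ * _); rewrite !mulmxBl !linearB /= -!scalemxAl linearZ /= !mulmxA.
rewrite (mulmxK uR).
(* This rotation makes the two [A^T] terms equal with opposite signs. *)
have -> : \tr (S *m D *m A^T *m S *m D) = \tr (A^T *m S *m D *m S *m D).
  by rewrite -(mulmxA _ S D) mxtrace_mulC mulmxA mxtrace_mulC !mulmxA.
have -> : \tr (S *m S *m D *m S *m D) = \tr (S *m D *m S *m D *m S).
  by rewrite -!mulmxA mxtrace_mulC !mulmxA.
have -> : \tr (S *m D *m G *m D) = \tr (G *m D *m S *m D).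
  by rewrite -(mulmxA _ G D) mxtrace_mulC !mulmxA.
by rewrite subrr sub0r opprD.
Qed.

End Riccati.

(** * Trace inequalities for positive semidefinite matrices *)

Section PositiveForms.
Context {K : realFieldType} {r : nat}.
Implicit Types R M : 'M[K]_r.

(** The diagonal entries of [Y^T *m M *m Y] are the values of the form [M] at the columns of [Y]. *)
Lemma psd_trace_congr q M (Y : 'M[K]_(r, q)) :
  (forall v : 'cV[K]_r, 0 <= (v^T *m M *m v) ord0 ord0) ->
  0 <= \tr (Y^T *m M *m Y).
Proof.
move=> M0; apply: sumr_ge0 => k _.
have -> : (Y^T *m M *m Y) k k = ((col k Y)^T *m M *m col k Y) ord0 ord0.
  rewrite !mxE; apply: eq_bigr => j _; rewrite !mxE; congr (_ * _).
  by apply: eq_bigr => l _; rewrite !mxE.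
exact: M0.
Qed.

Lemma psd_trace_mul_le (b : K) R M :
  (forall i j, `|R i j| <= b) -> M^T = M ->
  (forall v : 'cV[K]_r, 0 <= (v^T *m M *m v) ord0 ord0) ->
  \tr (R *m M) <= r%:R * b * \tr M.
Proof.
move=> Rb symM M0.
(* This is the form [M] evaluated at e_i + c e_j. *)
have form (c : K) i j : 0 <= M i i + c * M i j + c * M j i + c ^+ 2 * M j j.
  have := M0 (delta_mx i ord0 + c *: delta_mx j ord0).
  have -> : (delta_mx i ord0 + c *: delta_mx j ord0)^T =
      delta_mx ord0 i + c *: delta_mx ord0 j :> 'rV[K]_r.
    by rewrite linearD linearZ /= !trmx_delta.
  rewrite !(mulmxDl, mulmxDr) -!(scalemxAl, scalemxAr) -!rowE -!colE !mxE.
  by congr (0 <= _); ring.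
(* Positivity on e_i + e_j and e_i - e_j gives |M_ij| <= (M_ii + M_jj) / 2. *)
have entry i j : R i j * M j i <= b * ((M i i + M j j) / 2).
  have := form 1 i j; have := form (-1) i j.
  have -> : M i j = M j i by rewrite -[in LHS]symM mxE.
  move=> h1 h2.
  apply: le_trans (ler_norm _) _; rewrite normrM; apply: ler_pM => //.
  by rewrite ler_norml; lra.
have -> : \tr (R *m M) = \sum_i \sum_j R i j * M j i.
  by apply: eq_bigr => i _; rewrite mxE.
apply: (@le_trans _ _ (\sum_i \sum_j b * ((M i i + M j j) / 2))).
  by apply: ler_sum => i _; apply: ler_sum => j _.
(* The half-sums over all pairs count each diagonal entry [r] times, which is where the factor [r]
   comes from. *)
have trE : \sum_(i < r) \sum_(j < r) M i i = r%:R * \tr M.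
  rewrite mulr_sumr; apply: eq_bigr => i _.
  by rewrite sumr_const card_ord mulr_natl.
have -> : \sum_i \sum_j b * ((M i i + M j j) / 2) =
    b * ((r%:R * \tr M + r%:R * \tr M) / 2).
  rewrite -{1}trE -trE [X in _ + X]exchange_big /= -big_split /=.
  rewrite mulr_suml mulr_sumr.
  apply: eq_bigr => i _; rewrite -big_split /= mulr_suml mulr_sumr.
  by apply: eq_bigr.
by rewrite le_eqVlt; apply/orP; left; apply/eqP; field.
Qed.

End PositiveForms.

(** * Positive definite matrices and the bound drawn from compactness *)

Lemma pos_def_unitmx (K : realType) r (R : 'M[K]_r) :
  pos_def R -> R \in unitmx.
Proof.
move=> [_ Rpos]; rewrite -row_free_unit -kermx_eq0; apply/rowV0P => v.
move=> /sub_kermxP vR; apply: contrapT => /eqP v0.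
by have := Rpos v^T; rewrite trmx_eq0 trmxK vR mul0mx mxE ltxx => /(_ v0).
Qed.

(** The form of R^-1 at v is the form of R at R^-1 v. *)
Lemma pos_def_invmx_ge0 (K : realType) r (R : 'M[K]_r) (v : 'cV[K]_r) :
  pos_def R -> 0 <= (v^T *m invmx R *m v) ord0 ord0.
Proof.
move=> Rp; have uR := pos_def_unitmx Rp; case: Rp => symR Rpos.
have -> : v^T *m invmx R *m v = (invmx R *m v)^T *m R *m (invmx R *m v).
  by rewrite trmx_mul trmx_inv symR !mulmxA mulmxKV.
have [->|v0] := eqVneq (invmx R *m v) 0; last exact/ltW/Rpos.
by rewrite mulmx0 mxE.
Qed.

(** As U^T U = 1, R = U^T P U depends continuously on P = U R U^T, so it stays bounded over a
    compact set; the matrix norm is the largest absolute value of an entry. *)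
Lemma stiefel_congr_entry_bound (K : realType) r n (U : 'M[K]_(n, r))
    (N : set 'M[K]_n) :
  stiefel U -> compact N ->
  exists2 b : K, 0 < b &
    forall R : 'M[K]_r, N (U *m R *m U^T) -> forall i j, `|R i j| <= b.
Proof.
move=> UU compactN.
have UK (R : 'M[K]_r) : U^T *m (U *m R *m U^T) *m U = R.
  by rewrite !mulmxA UU mul1mx -mulmxA UU mulmx1.
have cf : continuous (fun P : 'M[K]_n => U^T *m P *m U).
  move=> P; apply: differentiable_continuous.
  by apply: differentiable_mulmx => //; exact: differentiable_mulmx.
have /compact_bounded [b [_ hb]] :=
  continuous_compact (continuous_subspaceT cf) compactN.
(* Norms are bounded by every number strictly above [b], whose sign is unknown; |b| + 1 is such a
   number and is positive. *)
exists (`|b| + 1) => [|R NR i j]; first by rewrite ltr_wpDl.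
have : `|R| <= `|b| + 1.
  apply: (hb (`|b| + 1)); first by rewrite (le_lt_trans (ler_norm b))// ltrDl.
  by exists (U *m R *m U^T).
apply: le_trans; rewrite [leRHS]/Num.Def.normr/= mx_normrE.
exact: (le_bigmax _ _ (i, j)).
Qed.

(** * Contraction estimate along a fixed span *)

Theorem lemma3 (K : realType) (r n p q : nat) (mu : K)
    (A : K -> 'M[K]_n) (C : K -> 'M[K]_(p, n)) (H : K -> 'M[K]_(p, q))
    (hr : (1 <= r)%N) (hrn : (r < n)%N) (hmu : 0 < mu)
    (smoothA : smooth A) (smoothC : smooth C) (smoothH : smooth H)
    (unitA : forall t, A t \in unitmx)
    (unitHH : forall t, H t *m (H t)^T \in unitmx)
    (N : set 'M[K]_n) (compactN : compact N) (N_sub : N `<=` psd_rank r (n := n))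
    (U : 'M[K]_(n, r)) (stiefelU : stiefel U)
    (spanN : forall P, N P -> same_span P U) :
  strict_contraction (pos_def (r := r)) (symmetric_matrices (r := r))
    (fun R D1 D2 => lowrank_metric (U, R) (0, D1) (0, D2))
    (fun t R => (lowrank_riccati mu A C H t (U, R)).2)
    [set R | N (U *m R *m U^T)].
Proof.
have [b b0 Nb] := stiefel_congr_entry_bound stiefelU compactN.
exists (mu ^+ 2 / (r%:R * b)).
  by rewrite divr_gt0 ?exprn_gt0 // mulr_gt0 // ltr0n.
move=> I x dx openI _ posx symdx solx soldx t It Nt e.
set a := U^T *m A t *m U.
set W := invmx (H t *m (H t)^T).
(* Since W is symmetric and W (H H^T) W = W, F F^T equals C_U^T W C_U: the quadratic coefficient is
   a Gram matrix. *)
pose F := (C t *m U)^T *m W *m H t.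
pose G := F *m F^T.
have symW : W^T = W by rewrite /W trmx_inv trmx_mul trmxK.
have GE : G = (C t *m U)^T *m W *m (C t *m U).
  rewrite /G /F !trmx_mul !trmxK symW !mulmxA.
  by rewrite -(mulmxA _ (H t) (H t)^T) mulmxKV.
clearbody F.
have rhsE R : (lowrank_riccati mu A C H t (U, R)).2 =
    a *m R + R *m a^T + (mu ^+ 2)%:M - R *m G *m R.
  by rewrite GE /lowrank_riccati /= !mulmxA.
have hx := solx t It; have hdx := soldx t It.
rewrite rhsE in hx; rewrite /linearization (funext rhsE) in hdx.
rewrite -deriveE in hdx; last exact: differentiable_riccati.
have [_ dF] := is_derive_riccati a a^T (mu ^+ 2)%:M G (x t) (dx t).
rewrite {}dF in hdx.
(* Openness of [I] gives invertibility on a neighbourhood of [t], as differentiating the inverse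
   requires. *)
have ux : \forall s \near t, x s \in unitmx.
  by apply: filterS (open_nbhs_nbhs (conj openI It)) => s /posx/pos_def_unitmx.
have uxt := nbhs_singleton ux.
have symx : (x t)^T = x t by case: (posx t It).
have symS : (invmx (x t))^T = invmx (x t) by rewrite trmx_inv symx.
have symD : (dx t)^T = dx t := symdx t It.
have eE : e = fun s => \tr (invmx (x s) *m dx s *m (invmx (x s) *m dx s)).
  apply/funext => s.
  by rewrite /e /lowrank_metric /= mulmx0 mxtrace0 add0r mulmxA.
have hX := is_derive_mulmx (is_derive_invmx ux hx) hdx.
have [de dE] := is_derive_mxtrace (is_derive_mulmx hX hX).
set S := invmx (x t) in symS *; set D := dx t in symD *.
have deE : derive1 e t = - 2 *
    (mu ^+ 2 * \tr (S *m D *m S *m D *m S) + \tr (G *m D *m S *m D)).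
  by rewrite derive1E eE dE /=; exact: trace_riccati.
split; first by rewrite eE.
rewrite deE eE -/S -/D.
have trE : \tr (S *m D *m (S *m D)) = \tr (x t *m (S *m D *m S *m D *m S)).
  by rewrite [RHS]mxtrace_mulC mulmxKV // mulmxA.
have S0 v : 0 <= (v^T *m S *m v) ord0 ord0 := pos_def_invmx_ge0 v (posx t It).
(* A congruence of [S], hence positive semidefinite. *)
have ME : S *m D *m S *m D *m S = (D *m S)^T *m S *m (D *m S).
  by rewrite trmx_mul symS symD !mulmxA.
have M0 (v : 'cV_r) : 0 <= (v^T *m (S *m D *m S *m D *m S) *m v) ord0 ord0.
  have -> : v^T *m (S *m D *m S *m D *m S) *m v =
      (D *m S *m v)^T *m S *m (D *m S *m v).
    by rewrite ME !trmx_mul !mulmxA.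
  exact: S0.
have G0 : 0 <= \tr (G *m D *m S *m D).
  (* With G = F F^T, rotating the leading [F] to the end leaves a congruence of [S] by [D *m F]. *)
  have -> : \tr (G *m D *m S *m D) = \tr ((D *m F)^T *m S *m (D *m F)).
    by rewrite /G trmx_mul symD -!mulmxA mxtrace_mulC !mulmxA.
  exact: psd_trace_congr.
have symM : (S *m D *m S *m D *m S)^T = S *m D *m S *m D *m S.
  by rewrite !trmx_mul symS symD !mulmxA.
have := psd_trace_mul_le (Nb _ Nt) symM M0.
rewrite -trE => le_e.
have : mu ^+ 2 / (r%:R * b) * \tr (S *m D *m (S *m D)) <=
    mu ^+ 2 * \tr (S *m D *m S *m D *m S).
  rewrite -mulrA; apply: ler_wpM2l; first exact/exprn_ge0/ltW.
  by rewrite ler_pdivrMl // mulr_gt0 // ltr0n.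
by move: G0; lra.
Qed.
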